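(* Let $\epsilon>0$, let $N$ be a positive integer, $h=2\pi/N$, and let $G:\mathbb{R}^N\to\mathbb{R}^N$, $G(\mathbf{u})=\epsilon D\mathbf{u}+\frac1\epsilon f(\mathbf{u})$, be the right-hand side of the finite-difference semi-discretization of the Allen--Cahn equation. Consider the $s$-stage explicit Runge--Kutta scheme in Shu--Osher form $$v_0=u_n,\qquad v_i=\sum_{k=0}^{i-1}\bigl(\alpha_{ik}v_k+\tau\beta_{ik}G(v_k)\bigr)\quad(1\le i\le s),\qquad u_{n+1}=v_s,$$ and suppose that $\sum_{k=0}^{i-1}\alpha_{ik}=1$ for $1\le i\le s$, that $\alpha_{ik}\ge0$ and $\beta_{ik}\ge 0$ for all $0\le k<i\le s$, and that $\beta_{ik}=0$ whenever $\alpha_{ik}=0$. Then $$\|u_n\|_\infty\le 1\ \Longrightarrow\ \|u_{n+1}\|_\infty\le 1$$ under the time-step restriction $$\tau\le\tau_{SSP}:=\min_{0\le k<i\le s}\frac{\alpha_{ik}}{\beta_{ik}}\cdot\tau_0,\qquad \tau_0=\min\left\{\frac{h^2}{4\epsilon},\frac{\epsilon}{4}\right\},$$ where the ratio $\alpha_{ik}/\beta_{ik}$ is understood as $+\infty$ whenever $\beta_{ik}=0$.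
   Context: The time step $\tau$ is positive. The spatial domain is $[0,2\pi]$ with periodic boundary condition and mesh size $h=2\pi/N$. The matrix $D_1\in\mathbb{R}^{N\times N}$ is the periodic difference matrix $(D_1\mathbf{v})_j=\frac1h(\mathbf{v}_j-\mathbf{v}_{j-1})$ with indices modulo $N$, and $D=-D_1^TD_1$ is the central-difference discretization of the Laplacian, i.e. $(D\mathbf{v})_j=\frac{1}{h^2}(\mathbf{v}_{j+1}-2\mathbf{v}_j+\mathbf{v}_{j-1})$ with indices modulo $N$. The function $f(u)=u-u^3$ is applied componentwise to vectors, and $\|\cdot\|_\infty$ is the maximum norm on $\mathbb{R}^N$. *)

(* Defs.v *)
From HB Require Import structures.
From mathcomp Require Import all_boot all_order all_algebra.
From mathcomp Require Import reals constructive_ereal ereal topology.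
From mathcomp Require Import normedtype trigo.
Set Implicit Arguments.
Unset Strict Implicit.
Unset Printing Implicit Defensive.
Import Order.TTheory GRing.Theory Num.Theory.
Import numFieldNormedType.Exports.
Local Open Scope ring_scope.

Definition mesh (R : realType) (N : nat) : R := 2 * pi / N%:R.

(* [ord_pred j] is j - 1 modulo N.  For N = 1 both indicators hit the diagonal
   and cancel, so the difference matrix is 0, as it should be. *)
Definition D1 (R : realType) (N : nat) : 'M[R]_N :=
  \matrix_(j, k) (((k == j)%:R - (k == ord_pred j)%:R) / mesh R N).

Definition laplacian (R : realType) (N : nat) : 'M[R]_N :=
  - ((D1 R N)^T *m D1 R N).

Definition AC_f (R : realType) (u : R) : R := u - u ^+ 3.

Definition AC_rhs (R : realType) (N : nat) (eps : R) (u : 'cV[R]_N) : 'cV[R]_N :=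
  eps *: (laplacian R N *m u) + eps^-1 *: map_mx (@AC_f R) u.

(* Only the coefficients [alpha i k], [beta i k] with 0 <= k < i <= s matter. *)
Definition shu_osher_step (R : realType) (N s : nat) (alpha beta : nat -> nat -> R)
    (G : 'cV[R]_N -> 'cV[R]_N) (tau : R) (u u' : 'cV[R]_N) : Prop :=
  exists v : nat -> 'cV[R]_N,
    [/\ v 0%N = u,
        forall i, (1 <= i <= s)%N ->
          v i = \sum_(0 <= k < i)
                  (alpha i k *: v k + (tau * beta i k) *: G (v k))
      & u' = v s].

Definition SSP_ratio (R : realType) (a b : R) : \bar R :=
  if b == 0 then +oo%E else (a / b)%:E.

Definition tau0 (R : realType) (N : nat) (eps : R) : R :=
  Num.min (mesh R N ^+ 2 / (4 * eps)) (eps / 4).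

(* Extended-real valued: it is +oo when all [beta i k] vanish. *)
Definition tau_SSP (R : realType) (N s : nat) (alpha beta : nat -> nat -> R)
    (eps : R) : \bar R :=
  ((\big[Order.min/+oo]_(1 <= i < s.+1) \big[Order.min/+oo]_(0 <= k < i)
      SSP_ratio (alpha i k) (beta i k)) * (tau0 N eps)%:E)%E.

Lemma D1E (R : realType) (N : nat) (v : 'cV[R]_N) (j : 'I_N) :
  (D1 R N *m v) j 0 = (v j 0 - v (ord_pred j) 0) / mesh R N.
Proof.
rewrite mxE (eq_bigr (fun k => (k == j)%:R * (v k 0 / mesh R N)
  - (k == ord_pred j)%:R * (v k 0 / mesh R N))); last first.
  by move=> k _; rewrite mxE -mulrBl mulrAC mulrA.
rewrite sumrB mulrBl (bigD1 j)//= eqxx mul1r big1 ?addr0; last first.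
  by move=> k /negPf ->; rewrite mul0r.
rewrite (bigD1 (ord_pred j))//= eqxx mul1r big1 ?addr0// => k /negPf ->.
by rewrite mul0r.
Qed.

Lemma laplacianE (R : realType) (N : nat) (v : 'cV[R]_N) (j : 'I_N) :
  (laplacian R N *m v) j 0 =
  (v (ordS j) 0 - 2 * v j 0 + v (ord_pred j) 0) / mesh R N ^+ 2.
Proof.
rewrite mulNmx -mulmxA mxE; set w := D1 R N *m v; rewrite mxE.
rewrite (eq_bigr (fun k => (k == j)%:R * (w k 0 / mesh R N)
  - (k == ordS j)%:R * (w k 0 / mesh R N))); last first.
  move=> k _; rewrite !mxE -mulrBl mulrAC mulrA; congr (_ * _ / _).
  by rewrite (eq_sym j k) -(inj_eq (@ordS_inj N) j) ord_predK (eq_sym (ordS j)).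
rewrite sumrB (bigD1 j)//= eqxx mul1r big1 ?addr0; last first.
  by move=> k /negPf ->; rewrite mul0r.
rewrite (bigD1 (ordS j))//= eqxx mul1r big1 ?addr0; last first.
  by move=> k /negPf ->; rewrite mul0r.
rewrite /w !D1E ordSK -mulrBl -mulNr -mulrBl -mulNr -mulrA -invfM -expr2.
by congr (_ / _); rewrite !opprB mulr_natl mulr2n opprD !addrA addrAC.
Qed.

(* Main.v *)
(** Write a stage as [\sum_k (alpha i k *: v k + (tau * beta i k) *: G (v k))].
    The step restriction gives [tau * beta i k <= alpha i k * tau0] for every
    [k < i], so each summand is [alpha i k] times a forward Euler step of length
    at most [tau0].  Such an Euler step preserves the unit ball of the maximum
    norm, hence [v i] is a convex combination of vectors of that ball, and the
    ball is preserved by strong induction on the stage. *)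
Require Import Defs.
From HB Require Import structures.
From mathcomp Require Import all_boot all_order all_algebra.
From mathcomp Require Import reals constructive_ereal ereal topology.
From mathcomp Require Import normedtype trigo.
From mathcomp Require Import ring lra.
Import Order.TTheory GRing.Theory Num.Theory.
Import numFieldNormedType.Exports.
Local Open Scope ring_scope.

Lemma cV_norm_leP (R : realType) (n : nat) (v : 'cV[R]_n) (c : R) :
  0 <= c -> reflect (forall j, `|v j 0| <= c) (`|v| <= c).
Proof.
move=> c0; rewrite [`|v|]mx_normrE; apply: (iffP (bigmax_leP _ _ _ _)) => [[_ vc] j|vc].
  exact: (vc (j, 0)).
by split=> // -[j k] _ /=; rewrite ord1.
Qed.

(** One grid node of an Euler step: [x] is the nodal value, [y] and [z] its neighbours, [p] and [q]
    the diffusion and reaction numbers. *)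
Lemma scaled_euler_le (R : realFieldType) (a p q x y z : R) :
  0 <= p <= a / 4 -> 0 <= q <= a / 4 -> `|x| <= 1 -> y <= 1 -> z <= 1 ->
  a * x + (p * (y - 2 * x + z) + q * (x - x ^+ 3)) <= a.
Proof.
move=> /andP[p0 pa] /andP[q0 qa] /[!ler_norml] /andP[x1 x2] y1 z1.
(* The deficit from [a] splits into three nonnegative products. *)
have -> : a * x + (p * (y - 2 * x + z) + q * (x - x ^+ 3)) =
  a - p * (1 - y) - p * (1 - z)
    - (1 - x) * (a - 2 * p - q * (x * (1 + x))) by ring.
have py : 0 <= p * (1 - y) by rewrite mulr_ge0// subr_ge0.
have pz : 0 <= p * (1 - z) by rewrite mulr_ge0// subr_ge0.
(* Hence the last factor is at least [a - 2 * p - 2 * q], which is nonnegative because [p] and [q]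
   each take at most a quarter of [a]. *)
have xx : x * (1 + x) <= 2 by nra.
have qx : q * (x * (1 + x)) <= q * 2 by rewrite ler_wpM2l.
have : 0 <= (1 - x) * (a - 2 * p - q * (x * (1 + x))).
  by rewrite mulr_ge0//; lra.
lra.
Qed.

Lemma mesh_gt0 (R : realType) (N : nat) : (0 < N)%N -> 0 < mesh R N.
Proof. by move=> N0; rewrite divr_gt0 ?mulr_gt0 ?pi_gt0 ?ltr0n. Qed.

Lemma tau0_gt0 (R : realType) (N : nat) (eps : R) :
  (0 < N)%N -> 0 < eps -> 0 < tau0 N eps.
Proof.
move=> N0 e0; rewrite lt_min !divr_gt0 ?exprn_gt0 ?mesh_gt0//.
by rewrite mulr_gt0.
Qed.

(** For [a > 0] this is [a] times an Euler step of length [b / a]. The undivided form also covers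
    [a = 0], where [b] must vanish. *)
Lemma norm_euler_le (R : realType) (N : nat) (eps a b : R) (v : 'cV[R]_N) :
  (0 < N)%N -> 0 < eps -> 0 <= a -> 0 <= b <= a * tau0 N eps -> `|v| <= 1 ->
  `|a *: v + b *: AC_rhs eps v| <= a.
Proof.
move=> N0 e0 a0 /andP[b0 bt] /(cV_norm_leP _ _ _ _ ler01) v1.
have h0 : 0 < mesh R N ^+ 2 by rewrite exprn_gt0 ?mesh_gt0.
(* The first entry of the minimum [tau0] controls [p], the second controls [q]. *)
set p := b * eps / mesh R N ^+ 2; set q := b / eps.
have hp : 0 <= p <= a / 4.
  apply/andP; split; first by rewrite divr_ge0 ?(ltW h0)// mulr_ge0// ltW.
  rewrite /p ler_pdivrMr//.
  have -> : a / 4 * mesh R N ^+ 2 = a * (mesh R N ^+ 2 / (4 * eps)) * eps.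
    by field; rewrite gt_eqF.
  rewrite ler_wpM2r ?(ltW e0)//; apply: (le_trans bt).
  by rewrite ler_wpM2l// ge_min lexx.
have hq : 0 <= q <= a / 4.
  rewrite /q divr_ge0 ?(ltW e0)//= ler_pdivrMr//.
  apply: (le_trans bt); rewrite mulrAC -mulrA.
  by rewrite ler_wpM2l// ge_min lexx orbT.
apply/cV_norm_leP => // j.
have -> : (a *: v + b *: AC_rhs eps v) j 0 = a * v j 0 +
    (p * (v (ordS j) 0 - 2 * v j 0 + v (ord_pred j) 0)
      + q * (v j 0 - v j 0 ^+ 3)).
  rewrite mxE; congr (_ + _); first by rewrite mxE.
  by rewrite mxE mxE [X in b * (X + _)]mxE laplacianE !mxE /AC_f /p /q; ring.
have := v1 (ordS j); rewrite ler_norml => /andP[y1 y2].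
have := v1 (ord_pred j); rewrite ler_norml => /andP[z1 z2].
rewrite ler_norml; apply/andP; split; last exact: scaled_euler_le.
(* The Euler step is odd in [v]. *)
have := scaled_euler_le _ a p q (- v j 0) (- v (ordS j) 0) (- v (ord_pred j) 0).
rewrite normrN => /(_ hp hq (v1 j)) H.
have {}H := H ltac:(lra) ltac:(lra).
lra.
Qed.

Lemma tau_SSP_le (R : realType) (N s i k : nat) (alpha beta : nat -> nat -> R)
    (eps tau : R) :
  (0 < N)%N -> 0 < eps -> (k < i <= s)%N -> 0 <= alpha i k -> 0 <= beta i k ->
  (tau%:E <= tau_SSP N s alpha beta eps)%E ->
  tau * beta i k <= alpha i k * tau0 N eps.
Proof.
move=> N0 e0 /andP[ki si] a0; have t0 := tau0_gt0 _ _ _ N0 e0.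
rewrite le_eqVlt => /predU1P[<- _|b0 tS].
  by rewrite mulr0 mulr_ge0// ltW.
(* For [beta i k > 0] the ratio is finite; cancelling the positive factor [tau0] leaves a comparison
   of the double minimum with its [(i, k)] entry. *)
rewrite -ler_pdivlMr// mulrAC -lee_fin EFinM; apply: (le_trans tS).
rewrite lee_pmul2r ?lte_fin//.
apply: (@bigmin_inf_seq _ _ _ _ _ i) => //.
  by rewrite mem_index_iota ltnS si (leq_ltn_trans _ ki).
apply: (@bigmin_inf_seq _ _ _ _ _ k) => //; first by rewrite mem_index_iota.
by rewrite /SSP_ratio gt_eqF.
Qed.

Theorem theorem11 (R : realType) (eps tau : R) (N s : nat)
    (alpha beta : nat -> nat -> R) (un un1 : 'cV[R]_N)
    (heps : 0 < eps) (htau : 0 < tau) (hN : (0 < N)%N) (hs : (0 < s)%N)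
    (halpha_sum : forall i : nat, (1 <= i <= s)%N ->
       \sum_(0 <= k < i) alpha i k = 1)
    (halpha_ge0 : forall i k : nat, (k < i <= s)%N -> 0 <= alpha i k)
    (hbeta_ge0 : forall i k : nat, (k < i <= s)%N -> 0 <= beta i k)
    (hbeta_eq0 : forall i k : nat, (k < i <= s)%N ->
       alpha i k = 0 -> beta i k = 0)
    (hstep : shu_osher_step s alpha beta (AC_rhs eps) tau un un1)
    (hCFL : (tau%:E <= tau_SSP N s alpha beta eps)%E) :
  `|un| <= 1 -> `|un1| <= 1.
Proof.
case: hstep => v [v0 vS ->] un_le1.
suff : forall i, (i <= s)%N -> `|v i| <= 1 by apply.
elim/ltn_ind => -[|i] IH si; first by rewrite v0.
(* Writing the bound 1 as the sum of the weights lets the triangle inequality be closed term by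
   term. *)
rewrite vS// -(halpha_sum _ (si : (1 <= i.+1 <= s)%N)).
apply: (le_trans (ler_norm_sum _ _ _)).
apply: ler_sum_nat => k /andP[_ ki].
have kis : (k < i.+1 <= s)%N by rewrite ki.
apply: norm_euler_le => //; first exact: halpha_ge0.
  rewrite mulr_ge0 ?(ltW htau) ?hbeta_ge0//=.
  by apply: (tau_SSP_le _ _ s) => //; [exact: halpha_ge0|exact: hbeta_ge0].
by apply: IH => //; apply: leq_trans si; apply: ltnW.
Qed.
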